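(* Let $f:\mathbb{R}^m\to\mathbb{R}$ be a convex differentiable function, let $x^*\in\mathbb{R}^m$ be such that $f(x^* )=\inf_{x\in\mathbb{R}^m}f(x)$, and let $x_0\in\mathbb{R}^m$ be an initial condition. Assume that $\nabla f$ is $L$-Lipschitz continuous with respect to the Euclidean norm, where $L>0$. If the sequence $(x_n)_{n\ge 0}$ follows the gradient descent law $x_{n+1}=x_n-\eta\nabla f(x_n)$ for a step-size $0<\eta<2/L$, then \[ \eta\sum_{n=0}^\infty\big(f(x_n)-f(x^* )\big)\le\frac{\|x_0-x^*\|^2}{2}+\frac{\eta}{2(1-L\eta/2)}\,\big(f(x_0)-f(x^* )\big). \]
   Context: $\|\cdot\|$ is the Euclidean norm on $\mathbb{R}^m$. *)

(* Defs.v *)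
From HB Require Import structures.
From mathcomp Require Import all_boot all_order all_algebra.
From mathcomp Require Import all_classical all_reals all_analysis.
Set Implicit Arguments.
Unset Strict Implicit.
Unset Printing Implicit Defensive.
Import Order.TTheory GRing.Theory Num.Theory.
Import numFieldNormedType.Exports.
Local Open Scope classical_set_scope.
Local Open Scope ring_scope.

(* The library norm `|x| on 'rV[R]_m is the sup norm, hence this definition.
   Differentiability does not depend on the choice between the two, so
   [differentiable] can be used as is. *)
Definition enorm (R : realType) (m : nat) (x : 'rV[R]_m) : R :=
  Num.sqrt (\sum_(i < m) x 0 i ^+ 2).

Definition gradient (R : realType) (m : nat) (f : 'rV[R]_m -> R)
    (x : 'rV[R]_m) : 'rV[R]_m :=
  \row_(i < m) 'D_(delta_mx 0 i) f x.

(* Main.v *)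
(* The step x' = x - eta g, with g the gradient at x, gives two inequalities.
   The quadratic upper bound of an L-smooth function yields
     eta (1 - L eta / 2) |g|^2 <= f x - f x',
   and expanding the square together with convexity, f x - f xs <= <g, x - xs>,
   yields
     |x' - xs|^2 <= |x - xs|^2 - 2 eta (f x - f xs) + eta^2 |g|^2.
   Eliminating |g|^2 shows that
     |x - xs|^2 + eta / (1 - L eta / 2) (f x - f xs)
   decreases by at least 2 eta (f x - f xs) at each step; now telescope. *)
Require Import Defs.
From HB Require Import structures.
From mathcomp Require Import all_boot all_order all_algebra.
From mathcomp Require Import all_classical all_reals all_analysis.
From mathcomp Require Import ring lra.
Set Implicit Arguments.
Unset Strict Implicit.
Unset Printing Implicit Defensive.
Import Order.TTheory GRing.Theory Num.Theory.
Import numFieldNormedType.Exports.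
Local Open Scope classical_set_scope.
Local Open Scope ring_scope.

Definition dotv (R : realType) (m : nat) (u v : 'rV[R]_m) : R :=
  \sum_(i < m) u 0 i * v 0 i.

Section Dot.
Variables (R : realType) (m : nat).
Implicit Types (u v w : 'rV[R]_m) (c : R).

Lemma dotvC u v : dotv u v = dotv v u.
Proof. by apply: eq_bigr => i _; rewrite mulrC. Qed.

Lemma dotvDl u v w : dotv (u + v) w = dotv u w + dotv v w.
Proof. by rewrite -big_split; apply: eq_bigr => i _; rewrite mxE mulrDl. Qed.

Lemma dotvZl c u v : dotv (c *: u) v = c * dotv u v.
Proof. by rewrite big_distrr; apply: eq_bigr => i _; rewrite mxE -mulrA. Qed.

Lemma dotvNl u v : dotv (- u) v = - dotv u v.
Proof. by rewrite -scaleN1r dotvZl mulN1r. Qed.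

Lemma dotvBl u v w : dotv (u - v) w = dotv u w - dotv v w.
Proof. by rewrite dotvDl dotvNl. Qed.

Lemma dotvZr c u v : dotv u (c *: v) = c * dotv u v.
Proof. by rewrite dotvC dotvZl dotvC. Qed.

Lemma dotvNr u v : dotv u (- v) = - dotv u v.
Proof. by rewrite dotvC dotvNl dotvC. Qed.

Lemma dotvBr u v w : dotv u (v - w) = dotv u v - dotv u w.
Proof. by rewrite dotvC dotvBl dotvC (dotvC w). Qed.

Lemma dotv_ge0 u : 0 <= dotv u u.
Proof. by apply: sumr_ge0 => i _; rewrite -expr2 sqr_ge0. Qed.

Lemma enorm_ge0 u : 0 <= enorm u.
Proof. exact: sqrtr_ge0. Qed.

Lemma sqr_enorm u : enorm u ^+ 2 = dotv u u.
Proof. by rewrite sqr_sqrtr// sumr_ge0// => i _; rewrite sqr_ge0. Qed.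

Lemma enormZ c u : 0 <= c -> enorm (c *: u) = c * enorm u.
Proof.
move=> c_ge0; apply/eqP; rewrite -(@eqrXn2 _ 2) ?mulr_ge0 ?enorm_ge0//; apply/eqP.
by rewrite exprMn !sqr_enorm dotvZl dotvZr mulrA.
Qed.

(** Expand [0 <= dotv (u - c *: v) (u - c *: v)] and divide by [2 * c]. *)
Lemma dotv_young c u v : 0 < c -> dotv u v <= (dotv u u / c + c * dotv v v) / 2.
Proof.
move=> c_gt0; have := dotv_ge0 (u - c *: v).
rewrite dotvBl !dotvBr !dotvZl !dotvZr (dotvC v u) => h.
rewrite -subr_ge0 (_ : _ - _ = (dotv u u - c * dotv u v
    - (c * dotv u v - c * (c * dotv v v))) / (2 * c)).
  by rewrite divr_ge0// mulr_ge0// ltW.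
by field; rewrite gt_eqF.
Qed.

(** Stands in for Cauchy-Schwarz: in Young's inequality with weight [c], the hypothesis makes both
    terms at most [c * dotv v v]. *)
Lemma dotv_le_of_enorm c u v :
  0 < c -> enorm u <= c * enorm v -> dotv u v <= c * dotv v v.
Proof.
move=> c_gt0 uv; apply: le_trans (dotv_young u v c_gt0) _.
have : dotv u u <= c ^+ 2 * dotv v v.
  rewrite -!sqr_enorm -exprMn; apply: lerXn2r => //; rewrite nnegrE.
    exact: enorm_ge0.
  by rewrite mulr_ge0 ?enorm_ge0 ?ltW.
rewrite -subr_ge0 => h; rewrite -subr_ge0.
rewrite (_ : _ - _ = (c ^+ 2 * dotv v v - dotv u u) / (2 * c)).
  by rewrite divr_ge0// mulr_ge0// ltW.
by field; rewrite gt_eqF.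
Qed.

End Dot.

Section Gradient.
Variables (R : realType) (m : nat) (f : 'rV[R]_m -> R).
Hypothesis f_diff : forall y, differentiable f y.

Lemma derive_gradient x v : 'D_v f x = dotv (gradient f x) v.
Proof.
rewrite deriveE// {1}(row_sum_delta v) linear_sum; apply: eq_bigr => i _.
by rewrite linearZ /= mxE deriveE// mulrC.
Qed.

Lemma is_derive_line x v (t : R) :
  is_derive t (1 : R) (fun s : R => f (s *: v + x))
    (dotv (gradient f (t *: v + x)) v).
Proof.
(* The difference quotient of the restriction to the line at [t] is that of [f] at [t *: v + x] in
   direction [v]. *)
have E : (fun h : R => h^-1 *: (((fun s : R => f (s *: v + x)) \o shift t)
      (h *: (1 : R)) - f (t *: v + x)))
  = (fun h : R => h^-1 *: ((f \o shift (t *: v + x)) (h *: v)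
      - f (t *: v + x))).
  by apply/funext => h /=; rewrite [h *: 1]mulr1 scalerDl addrA.
apply: DeriveDef; rewrite /derivable /derive E; first exact: diff_derivable.
exact: derive_gradient.
Qed.

(** By convexity, the difference quotients of [f] at [x] towards [y] are at most [f y - f x] for
    steps in (0, 1]; the bound passes to the limit. *)
Lemma convex_gradient_le x y :
    convex_function [set: convex_lmodType 'rV[R]_m] f ->
  dotv (gradient f x) (y - x) <= f y - f x.
Proof.
move=> f_convex; rewrite -derive_gradient /derive.
have dv : derivable f x (y - x) by exact: diff_derivable.
(* Only positive steps [h] give convex combinations, so the limit is taken from the right. *)
rewrite cvg_at_rightE//; apply: limr_le.
  by apply/cvg_ex; eexists; exact: cvg_dnbhs_at_right dv.
near=> h.
have h_gt0 : 0 < h by near: h; exact: nbhs_right_gt.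
have h_le1 : h <= 1 by near: h; exact: nbhs_right_ltW.
have fh : f (h *: y + (1 - h) *: x) <= h * f y + (1 - h) * f x.
  exact: f_convex (Itv01 (ltW h_gt0) h_le1) y x (mem_setT _) (mem_setT _).
rewrite /= (_ : h *: (y - x) + x = h *: y + (1 - h) *: x); last first.
  by rewrite scalerBr scalerBl scale1r addrA addrAC.
rewrite [_ *: _]mulrC ler_pdivrMr//.
move: fh; set F := f _; lra.
Unshelve. all: by end_near. Qed.

Lemma smooth_upper_bound (L : R) x v : 0 < L ->
    (forall y z, enorm (gradient f y - gradient f z) <= L * enorm (y - z)) ->
  f (x + v) <= f x + dotv (gradient f x) v + L / 2 * dotv v v.
Proof.
move=> L_gt0 grad_lip.
pose g := gradient f x.
(* [h] is [f] along the segment minus its expected quadratic growth, so the claim is [h 1 <= h 0]. A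
   sign on the derivative of [h] gives this without integrating the gradient. *)
pose h (t : R) := f (t *: v + x) - (dotv g v * t + L / 2 * dotv v v * t ^+ 2).
have dh (t : R) : is_derive t (1 : R) h
    (dotv (gradient f (t *: v + x)) v - (dotv g v + L * dotv v v * t)).
  have ? := is_derive_line x v t.
  apply: is_deriveB.
  have := is_deriveD (is_deriveZ (dotv g v) (is_derive_id t (1 : R)))
    (is_deriveZ (L / 2 * dotv v v) (is_deriveX 2 (is_derive_id t (1 : R)))).
  move=> D; apply: (@is_derive_eq _ _ _ _ _ _ _ _ D).
  rewrite !/GRing.scale /= expr1; lra.
have : h 1 <= h 0.
  apply: (@ler0_derive1_nincr R h 0 1) => //.
  - move=> t; rewrite in_itv /= => /andP[t_gt0 _].
    rewrite derive1E derive_val.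
    (* The two points differ by [t *: v], so the gradients differ by at most [L * t * enorm v];
       [0 < t] makes this factor [L * t] positive. *)
    have : dotv (gradient f (t *: v + x) - g) v <= (L * t) * dotv v v.
      apply: dotv_le_of_enorm; first exact: mulr_gt0.
      by apply: le_trans (grad_lip _ _) _; rewrite addrK enormZ ?mulrA// ltW.
    rewrite dotvBl; lra.
  - apply: continuous_subspaceT => t.
    exact/differentiable_continuous/derivable1_diffP.
rewrite /h scale1r scale0r add0r (addrC v); lra.
Qed.

End Gradient.

Theorem lemma3p1 (R : realType) (m : nat) (f : 'rV[R]_m -> R)
    (xs x0 : 'rV[R]_m) (L eta : R) (x : nat -> 'rV[R]_m)
    (f_convex : convex_function [set: convex_lmodType 'rV[R]_m] f)
    (f_diff : forall y, differentiable f y)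
    (xs_min : (f xs)%:E = ereal_inf [set (f y)%:E | y in [set: 'rV[R]_m]])
    (L_gt0 : 0 < L)
    (grad_lip : forall y z,
      enorm (gradient f y - gradient f z) <= L * enorm (y - z))
    (eta_gt0 : 0 < eta) (eta_lt : eta < 2 / L)
    (x_init : x 0%N = x0)
    (x_step : forall n, x n.+1 = x n - eta *: gradient f (x n)) :
  (eta%:E * \sum_(0 <= n <oo) (f (x n) - f xs)%:E <=
   (enorm (x0 - xs) ^+ 2 / 2
    + eta / (2 * (1 - L * eta / 2)) * (f x0 - f xs))%:E)%E.
Proof.
have {xs_min} xs_le y : f xs <= f y.
  by rewrite -lee_fin xs_min; apply: ereal_inf_lbound; exists y.
have c_gt0 : 0 < 1 - L * eta / 2.
  by move: eta_lt; rewrite ltr_pdivlMr// => h; lra.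
set K := eta / (1 - L * eta / 2).
have K_gt0 : 0 < K by exact: divr_gt0.
pose d n := f (x n) - f xs.
pose E n := dotv (x n - xs) (x n - xs).
have step n : 2 * eta * d n <= (E n + K * d n) - (E n.+1 + K * d n.+1).
  pose g := gradient f (x n).
  have descent : eta * (1 - L * eta / 2) * dotv g g <= d n - d n.+1.
    have := smooth_upper_bound f_diff (x n) (- (eta *: g)) L_gt0 grad_lip.
    rewrite -x_step dotvNl !dotvNr dotvZl !dotvZr -/g /d; lra.
  have convex : d n <= dotv g (x n - xs).
    have := convex_gradient_le f_diff (x n) xs f_convex.
    rewrite -/g -(opprB (x n) xs) dotvNr /d; lra.
  have expand : E n.+1 = E n - 2 * eta * dotv g (x n - xs)
                         + eta ^+ 2 * dotv g g.
    rewrite /E x_step -/g addrAC; move: (x n - xs) => w; rewrite dotvBl !dotvBr !dotvZl !dotvZr.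
    by rewrite (dotvC _ g); ring.
  (* [K] is chosen so that [K * (eta * (1 - L * eta / 2)) = eta ^+ 2]: scaling [descent] by [K]
     bounds exactly the error term of [expand]. *)
  have gg : eta ^+ 2 * dotv g g <= K * (d n - d n.+1).
    rewrite (_ : eta ^+ 2 * _ = K * (eta * (1 - L * eta / 2) * dotv g g)).
      by rewrite ler_pM2l.
    by rewrite /K; field; lra.
  (* [convex] is multiplied by [eta] beforehand, since [lra] treats such products as atoms. *)
  have := ler_pM2l eta_gt0 (d n) (dotv g (x n - xs)).
  rewrite convex expand; lra.
have sum_le N : 2 * eta * (\sum_(0 <= n < N) d n) <= E 0%N + K * d 0%N.
  have : 2 * eta * (\sum_(0 <= n < N) d n) <= (E 0%N + K * d 0%N)
      - (E N + K * d N).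
    elim: N => [|N IH]; first by rewrite big_nil mulr0 subrr.
    by rewrite big_nat_recr //= mulrDr; have := step N; lra.
  have : 0 <= E N + K * d N.
    by rewrite addr_ge0 ?dotv_ge0// mulr_ge0 ?subr_ge0// ltW.
  lra.
have d_ge0 n : (0 <= (d n)%:E)%E by rewrite lee_fin subr_ge0.
rewrite -nneseriesZl => [|n _]; last exact: d_ge0.
(* A series of nonnegative terms has a limit in the extended reals, so a uniform bound on the
   partial sums suffices. *)
apply: lime_le.
  by apply: is_cvg_nneseries => n _ _; rewrite mule_ge0 ?d_ge0// lee_fin ltW.
apply: nearW => N.
under eq_bigr do rewrite -EFinM.
rewrite sumEFin lee_fin -big_distrr /= sqr_enorm -x_init.
have := sum_le N; rewrite -/(d 0%N) -/(E 0%N).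
(* The target bound is half of the one in [sum_le]. *)
rewrite (_ : eta / (2 * _) = K / 2) ?invfM; first by lra.
by rewrite /K; field; lra.
Qed.
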